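(* Let $G=(V,E,J)$ be a connected, unimodular, transitive weighted graph. For each $\beta\ge 0$ define \begin{align*} A_\beta &= \sum_{v,w,x,y \in V} T_\beta(o,w)T_\beta(o,v)T_\beta(w,x)T_\beta(v,x) T_\beta(v,y) T_\beta(y,x),\\ B_\beta &= \sum_{v,w,x,y \in V} T_\beta(o,w)T_\beta(o,v)T_\beta(w,x)T_\beta(v,x) T_\beta(w,y) T_\beta(v,y), \end{align*} and $\nabla_\beta=\sum_{x,y\in V}T_\beta(o,x)T_\beta(x,y)T_\beta(y,o)$, all of which belong to $[1,\infty]$. Then \[ B_\beta \leq A_\beta \leq \nabla_\beta^{2} \] for every $\beta \geq 0$.
   Context: A weighted graph $G=(V,E,J)$ is a countable (unoriented) graph $(V,E)$ together with non-negative weights $\{J_e:e\in E\}$ such that $\sum_{e\in E^\rightarrow_v}J_e<\infty$ for each $v\in V$, where $E^\rightarrow_v$ is the set of oriented edges emanating from $v$ (each unoriented edge corresponds to a pair of oppositely oriented edges). An automorphism of $G$ is a graph automorphism of $(V,E)$ preserving the weights; $\mathrm{Aut}(G)$ is the group of automorphisms. $G$ is transitive if any vertex can be mapped to any other by an automorphism; $o$ denotes a fixed vertex. A connected transitive weighted graph is unimodular if $\sum_{x\in V}F(o,x)=\sum_{x\in V}F(x,o)$ for every $F:V\times V\to[0,\infty]$ with $F(\gamma x,\gamma y)=F(x,y)$ for all $x,y\in V$, $\gamma\in\mathrm{Aut}(G)$. For $\beta\ge 0$, Bernoulli-$\beta$ bond percolation on $G$ is the random subgraph in which each edge $e$ is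 independently retained (open) with probability $1-e^{-\beta J_e}$ and otherwise deleted (closed); its law is $\mathbb{P}_\beta$. $T_\beta(x,y)=\mathbb{P}_\beta(x\leftrightarrow y)$ is the probability that $x$ and $y$ are connected by an open path (so $T_\beta(x,x)=1$). *)

(* Defs.v *)
From HB Require Import structures.
From mathcomp Require Import all_boot all_order all_algebra.
From mathcomp Require Import all_classical all_reals all_analysis.

Set Implicit Arguments.
Unset Strict Implicit.
Unset Printing Implicit Defensive.

Import Order.TTheory GRing.Theory Num.Theory.
Import numFieldNormedType.Exports.

Local Open Scope classical_set_scope.
Local Open Scope ring_scope.

(* Loops and multiple edges are allowed.  The pair [endpoints e] fixes an
   arbitrary reference orientation of the unoriented edge [e]; the two oriented
   edges above [e] are [(e, false)] and [(e, true)].  In particular a loop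
   counts twice among the oriented edges emanating from its endpoint. *)
Definition tail (V E : Type) (endpoints : E -> V * V) (a : E * bool) : V :=
  if a.2 then (endpoints a.1).2 else (endpoints a.1).1.

Definition head (V E : Type) (endpoints : E -> V * V) (a : E * bool) : V :=
  if a.2 then (endpoints a.1).1 else (endpoints a.1).2.

Record weighted_graph (R : realType) := WeightedGraph {
  vertex : countType;
  edge : countType;
  endpoints : edge -> vertex * vertex;
  weight : edge -> R;
  weight_ge0 : forall e, 0 <= weight e;
  weight_summable : forall v,
    (\esum_(a in [set a | tail endpoints a = v]) (weight a.1)%:E < +oo)%E }.

Arguments vertex {R} w.
Arguments edge {R} w.
Arguments endpoints {R w} _.
Arguments weight {R w} _.

Section Graph.
Context {R : realType} (G : weighted_graph R).
Local Notation V := (vertex G).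
Local Notation E := (edge G).

Fixpoint walk (x : V) (p : seq (E * bool)) (y : V) : bool :=
  if p is a :: p' then
    (tail endpoints a == x) && walk (head endpoints a) p' y
  else x == y.

Definition joined (S : pred E) (x y : V) : Prop :=
  exists p, walk x p y /\ all S [seq a.1 | a <- p].

Definition connected_graph : Prop := forall x y, joined predT x y.

Record is_automorphism (g : V -> V) (h : E -> E) : Prop := {
  aut_vertex_bij : bijective g;
  aut_edge_bij : bijective h;
  aut_endpoints : forall e,
    endpoints (h e) = (g (endpoints e).1, g (endpoints e).2) \/
    endpoints (h e) = (g (endpoints e).2, g (endpoints e).1);
  aut_weight : forall e, weight (h e) = weight e }.

Definition transitive_graph : Prop :=
  forall x y, exists g h, is_automorphism g h /\ g x = y.

Definition unimodular (o : V) : Prop :=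
  forall F : V -> V -> \bar R,
    (forall x y, 0 <= F x y)%E ->
    (forall g h, is_automorphism g h -> forall x y, F (g x) (g y) = F x y) ->
    \esum_(x in [set: V]) F o x = \esum_(x in [set: V]) F x o.

End Graph.

Section Percolation.
Context {d : measure_display} {Omega : measurableType d} {R : realType}.
Variable P : probability Omega R.

Definition mutually_independent (I : eqType) (A : I -> set Omega) : Prop :=
  forall s : seq I, uniq s ->
    P (\big[setI/setT]_(i <- s) A i) = (\prod_(i <- s) P (A i))%E.

Variable G : weighted_graph R.

(* The random subgraph is given by a family of events on an arbitrary
   probability space, [is_open e] being the event that [e] is retained.  These
   conditions determine its law. *)
Record bernoulli_percolation (beta : R) (is_open : edge G -> set Omega) : Prop := {
  perc_measurable : forall e, measurable (is_open e);
  perc_prob : forall e, P (is_open e) = (1 - expR (- (beta * weight e)))%:E;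
  perc_independent : mutually_independent is_open }.

Definition two_point (is_open : edge G -> set Omega) (x y : vertex G) : \bar R :=
  P [set w | joined (fun e => `[< is_open e w >]) x y].

End Percolation.

Section Diagrams.
Context {R : realType} {V : choiceType}.
Variables (T : V -> V -> \bar R) (o : V).
Local Open Scope ereal_scope.

Definition diagram_A : \bar R :=
  \esum_(v in [set: V]) \esum_(w in [set: V])
  \esum_(x in [set: V]) \esum_(y in [set: V])
    (T o w * T o v * T w x * T v x * T v y * T y x).

Definition diagram_B : \bar R :=
  \esum_(v in [set: V]) \esum_(w in [set: V])
  \esum_(x in [set: V]) \esum_(y in [set: V])
    (T o w * T o v * T w x * T v x * T w y * T v y).

Definition triangle : \bar R :=
  \esum_(x in [set: V]) \esum_(y in [set: V]) (T o x * T x y * T y o).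

End Diagrams.

(* Main.v *)
Require Import Defs.
From HB Require Import structures.
From mathcomp Require Import all_boot all_order all_algebra.
From mathcomp Require Import all_classical all_reals all_analysis.
From mathcomp Require Import ring lra.

Set Implicit Arguments.
Unset Strict Implicit.
Unset Printing Implicit Defensive.

Import Order.TTheory GRing.Theory Num.Theory.

Local Open Scope classical_set_scope.
Local Open Scope ring_scope.

(** Write $t(x,y)$ for the probability that $x$ and $y$ are connected.  Two facts
about $t$ carry the proof.

Positivity ([psd_average_equivalence], [two_point_schur]): connection is an
equivalence relation for every realisation, an equivalence relation is a
block-diagonal 0-1 kernel, and multiplying a positive semidefinite kernel by such
a block indicator cuts its quadratic form into a sum of quadratic forms, one per
block.  Averaging, multiplication by $t$ preserves positive semidefiniteness, so
that $t$ and $t \otimes t$ are positive semidefinite.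

Invariance ([two_point_aut]): $t(gx,gy) = t(x,y)$ for every automorphism $g$.
Hence the triangle sum does not depend on its root, and unimodularity allows the
root of a diagram to be moved to any of its vertices ([mass_transport]).

The graph of $A$ is a 4-cycle with a triangle on one of its sides, that of $B$ a
4-cycle with a path of length 2 joining two opposite vertices.

For $B \le A$, root both diagrams at the end $o$ of the added path.  The kernel
$t(a,a') t(c,c')$ on pairs, tested against
$h(a,c) = t(a,c) (t(c,o) - t(a,o))$, gives a nonnegative sum over the 4-cycles
$a,c,c',a'$.  Expanding the product of the two differences, the side terms
$t(c,o) t(c',o)$ and $t(a,o) t(a',o)$ give two copies of $A$, and the diagonal
terms $t(c,o) t(a',o)$ and $t(a,o) t(c',o)$, with a minus sign, two copies of $B$
([diagram_B_le_rerooted_A]).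

For $A \le \nabla^2$, root $A$ at an end $o$ of the side shared by the cycle and
the triangle.  The rest of the cycle contributes
$\sum_{z,w} t(o,z) t(z,w) t(w,x)$, which is at most $\nabla$ by positivity tested
against $t(o,\cdot) - t(x,\cdot)$ ([open_triangle_le]); the remaining triangle
sums to another $\nabla$.

Positivity only concerns finite sums, with terms of both signs; it is used in
the form of an inequality between nonnegative sums over a finite square
$s \times s$, and a nonnegative sum over pairs is the supremum of its sums over
finite squares ([esum_square_le]). *)

(** * Unordered sums of nonnegative terms *)

Section UnorderedSums.
Context {R : realType}.
Local Open Scope ereal_scope.

Lemma esum_setT_le (I : choiceType) (a : I -> \bar R) (C : \bar R) :
  (forall s : seq I, uniq s -> \sum_(i <- s) a i <= C) ->
  \esum_(i in [set: I]) a i <= C.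
Proof.
move=> aC; apply: ge_ereal_sup => _ /= [X [finX _] <-].
by rewrite fsbig_finite// aC// finmap.fset_uniq.
Qed.

Lemma sum_le_esum_setT (I : choiceType) (a : I -> \bar R) (s : seq I) :
  uniq s -> \sum_(i <- s) a i <= \esum_(i in [set: I]) a i.
Proof.
move=> us; apply: esum_ge; exists [set` s]; last by rewrite -fsbig_seq.
by split => //; exact: finite_seq.
Qed.

Lemma esum_bij (I J : choiceType) (e : I -> J) (a : J -> \bar R) :
  bijective e -> \esum_(j in [set: J]) a j = \esum_(i in [set: I]) a (e i).
Proof. by move=> be; apply: reindex_esum; rewrite setTT_bijective. Qed.

Lemma esum_prod (I J : choiceType) (a : I -> J -> \bar R) :
  (forall i j, 0 <= a i j) ->
  \esum_(i in [set: I]) \esum_(j in [set: J]) a i j =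
  \esum_(k in [set: I * J]) a k.1 k.2.
Proof.
move=> a0; rewrite esum_esum//; congr esum.
by apply/seteqP; split.
Qed.

Lemma esum_quad (I : choiceType) (a : I -> I -> I -> I -> \bar R) :
  (forall v w x y, 0 <= a v w x y) ->
  \esum_(v in [set: I]) \esum_(w in [set: I])
  \esum_(x in [set: I]) \esum_(y in [set: I]) a v w x y =
  \esum_(k in [set: (I * I) * (I * I)]) a k.1.1 k.1.2 k.2.1 k.2.2.
Proof.
move=> a0; rewrite -(esum_prod (a := fun p q => a p.1 p.2 q.1 q.2))//.
rewrite -(esum_prod (a := fun v w =>
  \esum_(q in [set: I * I]) a v w q.1 q.2)); last first.
  by move=> v w; apply: esum_ge0.
apply: eq_esum => v _; apply: eq_esum => w _.
exact: (esum_prod (a := fun x y => a v w x y)).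
Qed.

Lemma esum_scale_le (I : choiceType) (a : I -> \bar R) (c : \bar R) :
  0 <= c -> (forall i, 0 <= a i) ->
  \esum_(i in [set: I]) (c * a i) <= c * \esum_(i in [set: I]) a i.
Proof.
move=> c0 a0; apply: esum_setT_le => s us.
by rewrite -ge0_sume_distrr// lee_wpmul2l// sum_le_esum_setT.
Qed.

(** Finite squares are cofinal among the finite sets of pairs.  This is how bounds
on quadratic forms over a finite set of indices pass to infinite sums. *)
Lemma esum_square_le (I : choiceType) (a : I -> I -> R) (C : \bar R) :
  (forall i j, 0 <= a i j)%R ->
  (forall s : seq I, uniq s -> (\sum_(i <- s) \sum_(j <- s) a i j)%:E <= C) ->
  \esum_(k in [set: I * I]) (a k.1 k.2)%:E <= C.
Proof.
move=> a0 aC; apply: esum_setT_le => s us.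
set u := undup (unzip1 s ++ unzip2 s).
apply: le_trans (aC u (undup_uniq _)).
rewrite sumEFin lee_fin.
rewrite -(big_allpairs (F := fun k => a k.1 k.2)).
set u2 := [seq _ | _ <- _, _ <- _].
have s_u2 : perm_eq s [seq k <- u2 | k \in s].
  apply: uniq_perm => //.
    by rewrite filter_uniq// allpairs_uniq ?undup_uniq// => -[? ?] [? ?].
  move=> [i j]; rewrite mem_filter; case: (boolP ((i, j) \in s)) => //= ijs.
  apply/esym/allpairsP; exists (i, j); split=> //=; rewrite mem_undup mem_cat.
    by apply/orP; left; apply/mapP; exists (i, j).
  by apply/orP; right; apply/mapP; exists (i, j).
by rewrite (perm_big _ s_u2) big_filter [leRHS](bigID (mem s)) /= lerDl sumr_ge0.
Qed.

Lemma square_le_esum (I : choiceType) (a : I -> I -> R) (s : seq I) :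
  uniq s -> (\sum_(i <- s) \sum_(j <- s) a i j)%:E <=
            \esum_(k in [set: I * I]) (a k.1 k.2)%:E.
Proof.
move=> us; rewrite -(big_allpairs (F := fun k => a k.1 k.2)) -sumEFin.
by apply: sum_le_esum_setT; rewrite allpairs_uniq// => -[? ?] [? ?].
Qed.

End UnorderedSums.

(** * Positive semidefinite kernels *)

Section PositiveSemidefinite.
Context {R : realType}.

(** The points [u i] need not be distinct and the weights [f] live on [J]: thus
pulling a kernel back along any map ([psd_comp]) needs no regrouping of terms. *)
Definition psd (I : Type) (K : I -> I -> R) : Prop :=
  forall (J : eqType) (s : seq J) (u : J -> I) (f : J -> R),
    0 <= \sum_(i <- s) \sum_(j <- s) K (u i) (u j) * (f i * f j).

Lemma psd_cst1 (I : Type) : psd (fun _ _ : I => 1).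
Proof.
move=> J s u f; under eq_bigr do under eq_bigr do rewrite mul1r.
by under eq_bigr do rewrite -mulr_sumr; rewrite -mulr_suml -expr2 sqr_ge0.
Qed.

Lemma psd_comp (I I' : Type) (r : I' -> I) (K : I -> I -> R) :
  psd K -> psd (fun i j => K (r i) (r j)).
Proof. by move=> Kpsd J s u f; apply: (Kpsd J s (r \o u)). Qed.

(** Cutting a kernel into its diagonal blocks, the fibres of [r], splits its
quadratic form into one form per block, each tested against the restriction of
the weights to that block. *)
Lemma psd_block (I : Type) (C : eqType) (r : I -> C) (K : I -> I -> R) :
  psd K -> psd (fun i j => (r i == r j)%:R * K i j).
Proof.
move=> Kpsd J s u f; set cs := undup [seq r (u i) | i <- s].
have -> : \sum_(i <- s) \sum_(j <- s)
    (r (u i) == r (u j))%:R * K (u i) (u j) * (f i * f j) =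
  \sum_(c <- cs) \sum_(i <- s) \sum_(j <- s)
    K (u i) (u j) * ((f i * (r (u i) == c)%:R) * (f j * (r (u j) == c)%:R)).
  rewrite [RHS]exchange_big /= big_seq [RHS]big_seq; apply: eq_bigr => i si.
  rewrite [RHS]exchange_big /=; apply: eq_bigr => j _.
  have ci : r (u i) \in cs by rewrite mem_undup map_f.
  rewrite (bigD1_seq (r (u i)))//= ?undup_uniq// big1 ?addr0; last first.
    by move=> c; rewrite eq_sym => /negPf ->; rewrite mulr0 mul0r mulr0.
  by rewrite eqxx (eq_sym (r (u i))) mulr1; ring.
by apply: sumr_ge0 => c _; apply: Kpsd.
Qed.

Lemma psd_average (d : measure_display) (Omega : measurableType d)
    (P : probability Omega R) (I : Type) (E : I -> I -> set Omega)
    (K : I -> I -> R) :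
  (forall i j, measurable (E i j)) ->
  (forall w, psd (fun i j => \1_(E i j) w * K i j)) ->
  psd (fun i j => fine (P (E i j)) * K i j).
Proof.
move=> mE Epsd J s u f.
pose c i j := K (u i) (u j) * (f i * f j).
pose X i j w := ((c i j)%:E * (\1_(E (u i) (u j)) w)%:E)%E : \bar R.
have intX i j : P.-integrable setT (X i j).
  by apply: integrableZl => //; apply: integrable_indic.
have EX i j : (\int[P]_w X i j w)%E = (fine (P (E (u i) (u j))) * c i j)%:E.
  rewrite integralZl//; last exact: integrable_indic.
  rewrite integral_indic// setIT [RHS]EFinM [LHS]muleC fineK//.
  exact: fin_num_measure.
have -> : \sum_(i <- s) \sum_(j <- s)
    fine (P (E (u i) (u j))) * K (u i) (u j) * (f i * f j) =
  fine (\int[P]_w \sum_(i <- s) \sum_(j <- s) X i j w)%E.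
  rewrite integral_sum//; last by move=> i; apply: integrable_sum.
  under [X in fine X]eq_bigr do rewrite integral_sum//.
  under [X in fine X]eq_bigr do under eq_bigr do rewrite EX.
  under [X in fine X]eq_bigr do rewrite sumEFin.
  rewrite sumEFin /=; apply: eq_bigr => i _; apply: eq_bigr => j _.
  by rewrite -mulrA.
apply: fine_ge0; apply: integral_ge0 => w _.
under eq_bigr do rewrite sumEFin.
rewrite sumEFin lee_fin; apply: le_trans (Epsd w J s u f) _.
rewrite le_eqVlt; apply/orP; left; apply/eqP.
by apply: eq_bigr => i _; apply: eq_bigr => j _; rewrite /c /=; ring.
Qed.

(** A random equivalence relation is, for each realisation, equality of chosen
representatives of the classes, so that [psd_block] applies before averaging.  With
[K] constant it says that connection probabilities are positive semidefinite;
a general [K] gives the Schur products needed for kernels on pairs. *)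
Lemma psd_average_equivalence (d : measure_display) (Omega : measurableType d)
    (P : probability Omega R) (V : choiceType) (eqv : Omega -> V -> V -> Prop)
    (I : Type) (r : I -> V) (K : I -> I -> R) :
  (forall w x, eqv w x x) -> (forall w x y, eqv w x y -> eqv w y x) ->
  (forall w x y z, eqv w x y -> eqv w y z -> eqv w x z) ->
  (forall x y, measurable [set w | eqv w x y]) ->
  psd K ->
  psd (fun i j => fine (P [set w | eqv w (r i) (r j)]) * K i j).
Proof.
move=> refl sym trans meas Kpsd.
apply: psd_average => [i j|w]; first exact: meas.
pose rep x := choose (fun y => `[< eqv w x y >]) x.
have repE x y : (rep x == rep y) = `[< eqv w x y >].
  apply/eqP/asboolP => [exy|xy].
    have rx z : eqv w z (rep z).
      apply/asboolP; apply: (@chooseP _ (fun y => `[< eqv w z y >])).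
      exact/asboolP.
    by apply: trans (rx x) _; rewrite exy; apply: sym.
  rewrite /rep (@eq_choose _ _ (fun z => `[< eqv w y z >])); last first.
    by move=> z; apply/asboolP/asboolP; [apply: trans; apply: sym|apply: trans].
  by apply: choose_id; apply/asboolP => //; apply: sym.
have := psd_block (rep \o r) Kpsd; congr (psd _).
apply/funext => i; apply/funext => j; rewrite /= repE indicE; congr (_%:R * _).
Qed.

End PositiveSemidefinite.

(** * Walks and automorphisms *)

Section Walks.
Context {R : realType} {G : weighted_graph R}.
Local Notation V := (vertex G).
Local Notation E := (edge G).
Implicit Types (x y z : V) (S : pred E) (a : E * bool) (p q : seq (E * bool)).

Lemma walk_cat x y z p q : walk x p y -> walk y q z -> walk x (p ++ q) z.
Proof.
elim: p x => [|a p IHp] x /=; first by move=> /eqP ->.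
by move=> /andP[-> /IHp].
Qed.

Lemma joined_refl S x : joined S x x.
Proof. by exists [::]; rewrite /= eqxx. Qed.

Lemma joined_trans S x y z : joined S x y -> joined S y z -> joined S x z.
Proof.
move=> [p [xpy Sp]] [q [yqz Sq]]; exists (p ++ q).
by rewrite (walk_cat xpy yqz) map_cat all_cat Sp Sq.
Qed.

Lemma joined_arc S a :
  S a.1 -> joined S (Defs.tail endpoints a) (Defs.head endpoints a).
Proof. by move=> Sa; exists [:: a]; rewrite /= !eqxx Sa. Qed.

Lemma joined_sym S x y : joined S x y -> joined S y x.
Proof.
move=> [p [xpy Sp]]; elim: p x xpy Sp => [|[e b] p IHp] x /=.
  by move=> /eqP -> _; exact: joined_refl.
move=> /andP[/eqP <- /IHp yh] /andP[Se /yh /joined_trans]; apply.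
have := @joined_arc S (e, ~~ b) Se.
by rewrite /Defs.tail /Defs.head; case: b {yh}.
Qed.

Lemma joined_aut (g : V -> V) (h : E -> E) S x y :
  is_automorphism g h -> joined (S \o h) x y -> joined S (g x) (g y).
Proof.
move=> gh [p [xpy Sp]]; elim: p x xpy Sp => [|[e b] p IHp] x /=.
  by move=> /eqP -> _; exact: joined_refl.
move=> /andP[/eqP <- /IHp hy] /andP[Se /hy]; apply: joined_trans.
(* An automorphism may reverse the reference orientation of an edge. *)
have [ends|ends] := aut_endpoints gh e.
  have := @joined_arc S (h e, b) Se.
  by rewrite /Defs.tail /Defs.head /= ends; case: b {hy}.
have := @joined_arc S (h e, ~~ b) Se.
by rewrite /Defs.tail /Defs.head /= ends; case: b {hy}.
Qed.

Lemma automorphism_inverse (g : V -> V) (h : E -> E) :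
  is_automorphism g h -> exists g' h',
    [/\ is_automorphism g' h', cancel g g' & cancel h' h].
Proof.
move=> [[g' gK g'K] [h' hK h'K] ends wgt]; exists g', h'.
split=> //; split; [by exists g|by exists h| |].
  move=> e; have [] := ends (h' e); rewrite h'K => ->; rewrite /= !gK.
    by left; case: (endpoints _).
  by right; case: (endpoints _).
by move=> e; rewrite -[RHS](congr1 weight (h'K e)) wgt.
Qed.

Lemma joined_autE (g : V -> V) (h : E -> E) S x y :
  is_automorphism g h -> joined S (g x) (g y) <-> joined (S \o h) x y.
Proof.
move=> gh; split; last exact: joined_aut.
have [g' [h' [gh' gK h'K]]] := automorphism_inverse gh.
have SE : S = (S \o h) \o h' by apply/funext => e /=; rewrite h'K.
by rewrite {1}SE => /(joined_aut gh'); rewrite !gK.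
Qed.

End Walks.

(** * Unions of cylinders *)

Section Cylinders.
Context {d : measure_display} {Omega : measurableType d} {R : realType}.
Context (P : probability Omega R).

Definition cylinder (I : eqType) (A : I -> set Omega) (s : seq I) : set Omega :=
  \big[setI/setT]_(i <- s) A i.

Lemma cylinderP (I : eqType) (A : I -> set Omega) (s : seq I) (w : Omega) :
  cylinder A s w <-> all (fun i => `[< A i w >]) s.
Proof.
rewrite /cylinder; elim: s => [|i s IHs]; first by rewrite big_nil.
rewrite big_cons /=; split=> [[Ai /IHs ->]|/andP[/asboolP Ai /IHs]] //.
by rewrite andbT; apply/asboolP.
Qed.

Lemma eq_cylinder (I : eqType) (A : I -> set Omega) (s t : seq I) :
  s =i t -> cylinder A s = cylinder A t.
Proof.
by move=> st; apply/seteqP; split=> w /cylinderP Aw; apply/cylinderP;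
  rewrite ?(eq_all_r st) // -(eq_all_r st).
Qed.

Lemma cylinder_nil (I : eqType) (A : I -> set Omega) : cylinder A [::] = setT.
Proof. by rewrite /cylinder big_nil. Qed.

Lemma cylinder_cat (I : eqType) (A : I -> set Omega) (s t : seq I) :
  cylinder A (s ++ t) = cylinder A s `&` cylinder A t.
Proof. by rewrite /cylinder big_cat. Qed.

Lemma measurable_cylinder (I : eqType) (A : I -> set Omega) (s : seq I) :
  (forall i, measurable (A i)) -> measurable (cylinder A s).
Proof. by move=> mA; apply: bigsetI_measurable. Qed.

(** Inclusion-exclusion, one cylinder of the union at a time.  The extra factor
[cylinder _ s] makes the induction go through: intersecting the union with the
next cylinder only enlarges [s]. *)
Lemma eq_measure_finite_union (I : eqType) (A B : I -> set Omega) :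
  (forall i, measurable (A i)) -> (forall i, measurable (B i)) ->
  (forall s, P (cylinder A s) = P (cylinder B s)) ->
  forall (l : seq (seq I)) (s : seq I),
    P (cylinder A s `&` \big[setU/set0]_(t <- l) cylinder A t) =
    P (cylinder B s `&` \big[setU/set0]_(t <- l) cylinder B t).
Proof.
move=> mA mB PAB; elim=> [|t l IHl] s; first by rewrite !big_nil !setI0.
have union C : (forall i, measurable (C i)) ->
    P (cylinder C s `&` \big[setU/set0]_(t <- t :: l) cylinder C t) =
    (P (cylinder C (s ++ t)) +
     P (cylinder C s `&` \big[setU/set0]_(t <- l) cylinder C t) -
     P (cylinder C (s ++ t) `&` \big[setU/set0]_(t <- l) cylinder C t))%E.
  move=> mC; rewrite big_cons setIUr cylinder_cat.
  have mU : measurable (\big[setU/set0]_(t <- l) cylinder C t).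
    by apply: bigsetU_measurable => u _; apply: measurable_cylinder.
  have mCy u := measurable_cylinder u mC.
  rewrite measureUfinl//; [|exact: measurableI|exact: measurableI|].
    by rewrite setIACA setIid setIA.
  by apply: le_lt_trans (probability_le1 P _) (ltry 1); apply: measurableI.
by rewrite !union// PAB !IHl.
Qed.

(** The probabilities of the cylinders determine those of their countable unions:
this is the part of the uniqueness of the law of percolation that connection
events require. *)
Lemma eq_measure_countable_union (I : choiceType) (A B : I -> set Omega)
    (U : countType) (c : U -> seq I) :
  (forall i, measurable (A i)) -> (forall i, measurable (B i)) ->
  (forall s, P (cylinder A s) = P (cylinder B s)) ->
  P (\bigcup_u cylinder A (c u)) = P (\bigcup_u cylinder B (c u)).
Proof.
move=> mA mB PAB.
pose l n := [seq c u | u <- pmap (@unpickle U) (iota 0 n)].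
pose F C n := \big[setU/set0]_(t <- l n) cylinder C t : set Omega.
have FP (C : I -> set Omega) n w : F C n w <->
    exists k u, [/\ (k < n)%N, unpickle k = Some u & cylinder C (c u) w].
  rewrite /F -bigcup_seq; split=> [[_ /mapP[u + ->] Cw]|[k [u [kn ku Cw]]]].
    rewrite mem_pmap => /mapP[k]; rewrite mem_iota add0n /= => kn uk.
    by exists k, u; rewrite -uk.
  exists (c u) => //; apply: map_f; rewrite mem_pmap -ku map_f//.
  by rewrite mem_iota.
have limF C : (forall i, measurable (C i)) ->
    P (F C n) @[n --> \oo] --> P (\bigcup_u cylinder C (c u)).
  move=> mC; have mF n : measurable (F C n).
    by apply: bigsetU_measurable => t _; apply: measurable_cylinder.
  have -> : \bigcup_u cylinder C (c u) = \bigcup_n F C n.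
    apply/seteqP; split=> w.
      move=> [u _ Cw]; exists (pickle u).+1 => //; apply/FP.
      by exists (pickle u), u; rewrite pickleK.
    by move=> [n _ /FP[k [u [_ _ Cw]]]]; exists u.
  apply: nondecreasing_cvg_mu => //; first exact: bigcupT_measurable.
  move=> m n mn; apply/subsetPset => w /FP[k [u [km ku Cw]]]; apply/FP.
  by exists k, u; rewrite (leq_trans km mn).
have := limF A mA; rewrite (_ : (fun n => P (F A n)) = fun n => P (F B n)).
  by move=> limA; apply: (cvg_unique _ limA (limF B mB)).
apply/funext => n; have := eq_measure_finite_union mA mB PAB (l n) [::].
by rewrite !cylinder_nil !setTI.
Qed.

End Cylinders.

(** * The two-point function *)

Section TwoPointFunction.
Context {d : measure_display} {Omega : measurableType d} {R : realType}.
Context (P : probability Omega R) (G : weighted_graph R).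
Local Notation V := (vertex G).
Local Notation E := (edge G).
Implicit Types (x y : V) (A : E -> set Omega).

Lemma joined_bigcup_cylinder A x y :
  [set w | joined (fun e => `[< A e w >]) x y] =
  \bigcup_(p : {p : seq (E * bool) | walk x p y})
    cylinder A [seq a.1 | a <- val p].
Proof.
apply/seteqP; split=> w.
  by move=> [p [xpy Ap]]; exists (Sub p xpy) => //; apply/cylinderP.
by move=> [[p xpy] _ /cylinderP Ap]; exists p.
Qed.

Lemma measurable_joined A x y : (forall e, measurable (A e)) ->
  measurable [set w | joined (fun e => `[< A e w >]) x y].
Proof.
move=> mA; rewrite joined_bigcup_cylinder.
apply: countable_bigcupT_measurable => [|p]; first exact: countableP.
exact: measurable_cylinder.
Qed.

(** The events [A (h e)] are independent with the same probabilities as the [A e],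
hence their cylinders have the same probabilities. *)
Lemma two_point_aut (beta : R) A (g : V -> V) (h : E -> E) x y :
  bernoulli_percolation P beta A -> is_automorphism g h ->
  two_point P A (g x) (g y) = two_point P A x y.
Proof.
move=> [mA PA indA] gh; rewrite /two_point.
have -> : [set w | joined (fun e => `[< A e w >]) (g x) (g y)] =
          [set w | joined (fun e => `[< (A \o h) e w >]) x y].
  by apply/seteqP; split=> w /(joined_autE (fun e => `[< A e w >]) x y gh).
have hI : injective h by apply: bij_inj; exact: aut_edge_bij gh.
rewrite !joined_bigcup_cylinder; apply: eq_measure_countable_union => [e|//|s].
  exact: mA.
(* Independence gives products over distinct edges only. *)
rewrite -!(@eq_cylinder _ _ _ _ (undup s) s); try exact: mem_undup.
rewrite /cylinder -(big_map h xpredT A) !indA ?map_inj_uniq ?undup_uniq//.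
rewrite big_map; apply: eq_bigr => e _.
by rewrite !PA (aut_weight gh).
Qed.

Lemma two_point_sym A x y : two_point P A x y = two_point P A y x.
Proof. by congr (P _); apply/seteqP; split=> w; exact: joined_sym. Qed.

Lemma two_point_diag A x : two_point P A x x = 1%E.
Proof.
rewrite -(probability_setT P); congr (P _).
by apply/seteqP; split=> // w _; exact: joined_refl.
Qed.

Lemma two_point_schur A (I : Type) (r : I -> V) (K : I -> I -> R) :
  (forall e, measurable (A e)) -> psd K ->
  psd (fun i j => fine (two_point P A (r i) (r j)) * K i j).
Proof.
move=> mA; apply: (@psd_average_equivalence _ _ _ P V
  (fun w => joined (fun e => `[< A e w >]))).
- by move=> w x; exact: joined_refl.
- by move=> w x y; exact: joined_sym.
- by move=> w x y z; exact: joined_trans.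
- by move=> x y; exact: measurable_joined.
Qed.

End TwoPointFunction.

(** * Moving the root of a diagram *)

Section MassTransport.
Context {R : realType} {G : weighted_graph R} {o : vertex G}.
Local Notation V := (vertex G).
Local Open Scope ereal_scope.

(** Mass [q x y a b c] summed over [a], [b], [c] is sent from [x] to [y]: what [o]
sends in total equals what it receives, which exchanges the first two vertices of
a five-vertex diagram. *)
Lemma mass_transport (q : V -> V -> V -> V -> V -> R) :
  unimodular o -> (forall x y a b c, 0 <= q x y a b c)%R ->
  (forall g h, is_automorphism g h -> forall x y a b c,
     q (g x) (g y) (g a) (g b) (g c) = q x y a b c) ->
  \esum_(k in [set: (V * V) * (V * V)])
    (q o k.1.1 k.1.2 k.2.1 k.2.2)%:E =
  \esum_(k in [set: (V * V) * (V * V)])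
    (q k.1.1 o k.1.2 k.2.1 k.2.2)%:E.
Proof.
move=> unim q0 qinv.
pose triple := (V * (V * V))%type.
pose F x y := \esum_(j in [set: triple]) (q x y j.1 j.2.1 j.2.2)%:E.
have assoc : bijective (fun k : V * triple => ((k.1, k.2.1), k.2.2)).
  by exists (fun k => (k.1.1, (k.1.2, k.2))) => [[? [? ?]]|[[? ?] ?]].
rewrite [LHS](esum_bij _ assoc) [RHS](esum_bij _ assoc).
rewrite -(esum_prod (a := fun y (j : triple) =>
  (q o y j.1 j.2.1 j.2.2)%:E)); last first.
  by move=> y j; rewrite lee_fin.
rewrite -(esum_prod (a := fun x (j : triple) =>
  (q x o j.1 j.2.1 j.2.2)%:E)); last first.
  by move=> x j; rewrite lee_fin.
apply: (unim F) => [x y|g h gh x y].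
  by apply: esum_ge0 => j _; rewrite lee_fin.
have gj : bijective (fun j : triple => (g j.1, (g j.2.1, g j.2.2))).
  have [g' gK g'K] := aut_vertex_bij gh.
  by exists (fun j => (g' j.1, (g' j.2.1, g' j.2.2))) => -[? [? ?]] /=;
    rewrite ?gK ?g'K.
by rewrite /F (esum_bij _ gj); apply: eq_esum => j _; rewrite (qinv g h gh).
Qed.

End MassTransport.

(** * Diagram inequalities for a symmetric kernel *)

Lemma le_of_doubled (R : realType) (b a : \bar R) : (b + b <= a + a -> b <= a)%E.
Proof.
case: b a => [b||] [a||] //; rewrite ?leNye ?leey// -?EFinD !lee_fin; lra.
Qed.

Section Diagrams.
Context {R : realType} {V : choiceType}.
Context (t : V -> V -> R).
Context (t_ge0 : forall x y, 0 <= t x y) (t_sym : forall x y, t x y = t y x).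
Local Notation T := (fun x y => (t x y)%:E).

Local Notation quad := ((V * V) * (V * V))%type.

Lemma diagram_AE o : diagram_A T o = \esum_(k in [set: quad])
  (t o k.1.2 * t o k.1.1 * t k.1.2 k.2.1 * t k.1.1 k.2.1 *
   t k.1.1 k.2.2 * t k.2.2 k.2.1)%:E.
Proof. by apply: esum_quad => v w x y; rewrite -!EFinM lee_fin !mulr_ge0. Qed.

Lemma diagram_BE o : diagram_B T o = \esum_(k in [set: quad])
  (t o k.1.2 * t o k.1.1 * t k.1.2 k.2.1 * t k.1.1 k.2.1 *
   t k.1.2 k.2.2 * t k.1.1 k.2.2)%:E.
Proof. by apply: esum_quad => v w x y; rewrite -!EFinM lee_fin !mulr_ge0. Qed.

Lemma triangleE o : triangle T o =
  \esum_(k in [set: V * V]) (t o k.1 * t k.1 k.2 * t k.2 o)%:E.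
Proof.
by apply: (esum_prod (a := fun x y => (t o x * t x y * t y o)%:E)) => x y;
  rewrite lee_fin !mulr_ge0.
Qed.

(** The weight of the 4-cycle [a], [c], [c'], [a'] for [k = ((a, c), (a', c'))]: its
sides [a c] and [a' c'] lie inside the two pairs, and [a a'] and [c c'] run between
them. *)
Definition cycle4 (k : quad) : R :=
  t k.1.1 k.1.2 * t k.2.1 k.2.2 * (t k.1.1 k.2.1 * t k.1.2 k.2.2).

(** Testing [t] against [t o - t x] gives [2 S o x <= S o o + S x x], where [S y z]
is the sum of the weights of the paths of length 3 from [y] to [z] whose inner
vertices lie in a given finite set. *)
Lemma open_triangle_le o x :
  psd t -> triangle T x = triangle T o ->
  (\esum_(k in [set: V * V]) (t o k.1 * t k.1 k.2 * t k.2 x)%:E <=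
   triangle T o)%E.
Proof.
move=> tpsd txo.
apply: (esum_square_le (a := fun a b => t o a * t a b * t b x)) => [a b|s us].
  by rewrite !mulr_ge0.
pose D a b y z := t y a * t a b * t b z.
have D_le y : ((\sum_(a <- s) \sum_(b <- s) D a b y y)%:E <= triangle T y)%E.
  by rewrite triangleE; apply: (square_le_esum (fun a b => D a b y y)).
apply: le_of_doubled; rewrite -{2}txo.
apply: le_trans (leeD (D_le o) (D_le x)).
rewrite -!EFinD lee_fin.
have := tpsd _ s id (fun a => t o a - t x a).
have -> : \sum_(i <- s) \sum_(j <- s) t i j * ((t o i - t x i) * (t o j - t x j)) =
  \sum_(i <- s) \sum_(j <- s) D i j o o + \sum_(i <- s) \sum_(j <- s) D i j x x
  - \sum_(i <- s) \sum_(j <- s) D i j o x - \sum_(i <- s) \sum_(j <- s) D i j o x.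
  rewrite [X in _ = _ - X]exchange_big -big_split -!sumrB; apply: eq_bigr => i _.
  rewrite -big_split -!sumrB; apply: eq_bigr => j _ /=.
  by rewrite /D (t_sym j o) (t_sym j x) (t_sym i x) (t_sym j i); ring.
by rewrite /D; lra.
Qed.

(** The right-hand side is [diagram_A] rooted at the vertex of degree 2 of its
triangle.  The kernel on pairs, tested against
[fun p => t p.1 p.2 * (t p.2 o - t p.1 o)], bounds the two diagonal terms
by the two side terms; [a2E], [b1E] and [b2E] identify the four sums obtained
through the symmetries of the 4-cycle. *)
Lemma diagram_B_le_rerooted_A o :
  psd (fun p q : V * V => t p.1 q.1 * t p.2 q.2) ->
  (diagram_B T o <= \esum_(k in [set: quad])
    (cycle4 k * (t k.1.2 o * t k.2.2 o))%:E)%E.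
Proof.
move=> tpsd.
pose swap (p : V * V) := (p.2, p.1).
have cyc_ge0 k : 0 <= cycle4 k by rewrite !mulr_ge0.
have a2E : \esum_(k in [set: quad]) (cycle4 k * (t k.1.2 o * t k.2.2 o))%:E =
           \esum_(k in [set: quad]) (cycle4 k * (t k.1.1 o * t k.2.1 o))%:E.
  have bij : bijective (fun k : quad => (swap k.1, swap k.2)).
    by apply: inv_bij => -[[? ?] [? ?]].
  rewrite [LHS](esum_bij _ bij); apply: eq_esum => k _; congr EFin.
  by rewrite /cycle4 /= (t_sym k.1.2 k.1.1) (t_sym k.2.2 k.2.1); ring.
have b1E : diagram_B T o = \esum_(k in [set: quad])
    (cycle4 k * (t k.1.2 o * t k.2.1 o))%:E.
  have bij : bijective (fun k : quad => ((k.1.2, k.2.1), (k.1.1, k.2.2))).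
    by exists (fun k => ((k.2.1, k.1.1), (k.1.2, k.2.2))) => -[[? ?] [? ?]].
  rewrite diagram_BE (esum_bij _ bij); apply: eq_esum => k _; congr EFin.
  rewrite /cycle4 /= !(t_sym o) (t_sym k.2.1 k.1.1) (t_sym k.1.2 k.1.1).
  ring.
have b2E : diagram_B T o = \esum_(k in [set: quad])
    (cycle4 k * (t k.1.1 o * t k.2.2 o))%:E.
  have bij : bijective (fun k : quad => ((k.1.1, k.2.2), (k.1.2, k.2.1))).
    by exists (fun k => ((k.1.1, k.2.1), (k.2.2, k.1.2))) => -[[? ?] [? ?]].
  rewrite diagram_BE (esum_bij _ bij); apply: eq_esum => k _; congr EFin.
  rewrite /cycle4 /= !(t_sym o) (t_sym k.2.2 k.1.2) (t_sym k.2.2 k.2.1).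
  ring.
apply: le_of_doubled; rewrite {1}b1E b2E {2}a2E.
have E0 x y z u k : (0 <= (cycle4 k * (t x y * t z u))%:E)%E.
  by rewrite lee_fin !mulr_ge0.
rewrite -!esumD//.
under eq_esum do rewrite -EFinD.
under [leRHS]eq_esum do rewrite -EFinD.
apply: (@esum_square_le _ (V * V)%type (fun p q =>
  cycle4 (p, q) * (t p.2 o * t q.1 o) + cycle4 (p, q) * (t p.1 o * t q.2 o))).
  by move=> p q; rewrite addr_ge0 ?mulr_ge0.
move=> s us; apply: le_trans (@square_le_esum _ (V * V)%type (fun p q =>
  cycle4 (p, q) * (t p.2 o * t q.2 o) +
  cycle4 (p, q) * (t p.1 o * t q.1 o)) s us).
rewrite lee_fin -subr_ge0.
have := tpsd _ s id (fun p => t p.1 p.2 * (t p.2 o - t p.1 o)).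
congr (0 <= _); rewrite -sumrB; apply: eq_bigr => p _.
by rewrite -sumrB; apply: eq_bigr => q _; rewrite /cycle4 /=; ring.
Qed.

(** The left-hand side is [diagram_A] rooted at a vertex of degree 3: [k.1] spans
the triangle and [k.2] the rest of the 4-cycle. *)
Lemma rerooted_A_le_triangle_sq o :
  (forall x, (\esum_(k in [set: V * V]) (t o k.1 * t k.1 k.2 * t k.2 x)%:E <=
     triangle T o)%E) ->
  (\esum_(k in [set: quad]) ((t o k.1.1 * t k.1.1 k.1.2 * t k.1.2 o) *
      (t o k.2.1 * t k.2.1 k.2.2 * t k.2.2 k.1.1))%:E <= triangle T o ^+ 2)%E.
Proof.
move=> open_le; rewrite expe2.
pose a (p : V * V) := t o p.1 * t p.1 p.2 * t p.2 o.
pose b (p q : V * V) := t o q.1 * t q.1 q.2 * t q.2 p.1.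
have a0 p : 0 <= a p by rewrite !mulr_ge0.
have b0 p q : 0 <= b p q by rewrite !mulr_ge0.
rewrite -(@esum_prod _ _ _ (fun p q => (a p * b p q)%:E)); last first.
  by move=> p q; rewrite lee_fin mulr_ge0.
have tri0 : (0 <= triangle T o)%E.
  by rewrite triangleE; apply: esum_ge0 => p _; rewrite lee_fin a0.
apply: (@le_trans _ _ (\esum_(p in [set: V * V]) (triangle T o * (a p)%:E)))%E.
  apply: le_esum => p _; rewrite muleC.
  under eq_esum do rewrite EFinM.
  apply: le_trans (esum_scale_le _ _) _ => [||].
  - by rewrite lee_fin.
  - by move=> q; rewrite lee_fin.
  - by rewrite lee_wpmul2l ?lee_fin//; exact: open_le.
apply: le_trans (esum_scale_le tri0 _) _ => [p|]; first by rewrite lee_fin.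
by rewrite [X in (_ <= _ * X)%E]triangleE.
Qed.

End Diagrams.

(** * The diagram bounds *)

Theorem proposition1p8 (R : realType) (G : weighted_graph R) (o : vertex G)
  (Gconn : connected_graph G) (Gtrans : transitive_graph G)
  (Gunim : unimodular o)
  (beta : R) (beta_ge0 : (0 <= beta)%R)
  (d : measure_display) (Omega : measurableType d) (P : probability Omega R)
  (is_open : edge G -> set Omega)
  (Hperc : bernoulli_percolation P beta is_open) :
  let T := two_point P is_open in
  [/\ (1 <= diagram_A T o)%E, (1 <= diagram_B T o)%E & (1 <= triangle T o)%E] /\
  ((diagram_B T o <= diagram_A T o)%E /\
   (diagram_A T o <= triangle T o ^+ 2)%E).
Proof.
move=> T; pose t x y := fine (T x y).
have mO := perc_measurable Hperc.
have TE : T = fun x y => (t x y)%:E.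
  apply/funext => x; apply/funext => y; rewrite /t fineK//.
  by apply: fin_num_measure; exact: measurable_joined.
have t_ge0 x y : 0 <= t x y by apply: fine_ge0; exact: measure_ge0.
have t_sym x y : t x y = t y x by rewrite /t /T two_point_sym.
have t_diag x : t x x = 1 by rewrite /t /T two_point_diag.
have t_aut g h : is_automorphism g h -> forall x y, t (g x) (g y) = t x y.
  by move=> gh x y; rewrite /t /T (two_point_aut _ _ Hperc gh).
have t_psd : psd t.
  have := two_point_schur P id mO (@psd_cst1 R (vertex G)).
  by congr psd; apply/funext => x; apply/funext => y; rewrite mulr1.
have tt_psd : psd (fun p q : vertex G * vertex G => t p.1 q.1 * t p.2 q.2).
  exact: (two_point_schur P fst mO (psd_comp snd t_psd)).
have triangle_const x : triangle T x = triangle T o.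
  have [g [h [gh <-]]] := Gtrans o x.
  have gg : bijective (fun p : vertex G * vertex G => (g p.1, g p.2)).
    have [g' gK g'K] := aut_vertex_bij gh.
    by exists (fun p => (g' p.1, g' p.2)) => -[y z] /=; rewrite ?gK ?g'K.
  rewrite TE !triangleE// (esum_bij _ gg); apply: eq_esum => p _ /=.
  by rewrite !(t_aut _ _ gh).
pose quad := ((vertex G * vertex G) * (vertex G * vertex G))%type.
(* The second argument of [q] is the vertex that takes over as root when
   [mass_transport] is applied to [q] itself; for the root [y], the arguments
   are permuted. *)
pose q (z v w x y : vertex G) :=
  t z w * t z v * t w x * t v x * t v y * t y x.
have q_ge0 z v w x y : 0 <= q z v w x y by rewrite !mulr_ge0.
have q_aut g h : is_automorphism g h -> forall z v w x y,
    q (g z) (g v) (g w) (g x) (g y) = q z v w x y.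
  by move=> gh z v w x y; rewrite /q !(t_aut _ _ gh).
have A_at_y : diagram_A T o =
    \esum_(k in [set: quad])
      (cycle4 t k * (t k.1.2 o * t k.2.2 o))%:E.
  have y_first :
      bijective (fun k : quad => ((k.1.2, k.2.1), (k.2.2, k.1.1))).
    by exists (fun k => ((k.2.2, k.1.1), (k.1.2, k.2.1))) => -[[? ?] [? ?]].
  rewrite TE diagram_AE// (esum_bij _ y_first).
  rewrite (mass_transport (q := fun z y v w x => q z v w x y))//; last first.
    by move=> g h gh x y a b c; exact: q_aut gh _ _ _ _ _.
  apply: eq_esum => k _; congr EFin.
  by rewrite /q /cycle4 /= (t_sym k.1.2 k.2.2) (t_sym o); ring.
have A_at_v : diagram_A T o =
    \esum_(k in [set: quad])
      ((t o k.1.1 * t k.1.1 k.1.2 * t k.1.2 o) *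
       (t o k.2.1 * t k.2.1 k.2.2 * t k.2.2 k.1.1))%:E.
  have swap : bijective (fun k : quad => (k.2, k.1)).
    by exists (fun k => (k.2, k.1)) => -[? ?].
  rewrite TE diagram_AE// (mass_transport (q := q))// (esum_bij _ swap).
  apply: eq_esum => k _; congr EFin.
  by rewrite /q /= (t_sym k.2.1 o) (t_sym k.1.2 k.1.1) (t_sym k.1.2 o); ring.
split.
  split; rewrite TE.
  (* The term in which all vertices equal [o] is 1. *)
  - rewrite diagram_AE//.
    apply: le_trans (@sum_le_esum_setT _ _ _ [:: ((o, o), (o, o))] isT).
    by rewrite big_seq1 /= !t_diag !mulr1.
  - rewrite diagram_BE//.
    apply: le_trans (@sum_le_esum_setT _ _ _ [:: ((o, o), (o, o))] isT).
    by rewrite big_seq1 /= !t_diag !mulr1.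
  - rewrite triangleE//.
    apply: le_trans (@sum_le_esum_setT _ _ _ [:: (o, o)] isT).
    by rewrite big_seq1 /= !t_diag !mulr1.
split.
  by rewrite A_at_y TE; apply: diagram_B_le_rerooted_A.
rewrite A_at_v TE; apply: rerooted_A_le_triangle_sq => // x.
by apply: open_triangle_le => //; rewrite -TE.
Qed.
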